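(* Let $\Sigma$, $\rho$, $E(x,y)$, $\mathbb Q$, $\mathbb{IQ}$ and $\mathcal I$ be as in the context. Then: (i) for each $J\in\mathbb{IQ}$ and each $f\in\Sigma$, the set $C(J)=\{x\in J\mid\nabla x=x=\Delta x\}$ is closed under $f^J$; (ii) the assignment $\mathcal C\colon\mathbb{IQ}\to\mathbb Q$ sending $J$ to the $\Sigma$-algebra $\mathcal C(J)$ with universe $C(J)$ and operations $f^J$ restricted to $C(J)$, and sending a homomorphism $g\colon J\to K$ to its restriction to $C(J)$, is a well-defined faithful functor (in particular $\mathcal C(J)\in\mathbb Q$); (iii) for each $A\in\mathbb Q$ the map $\iota_A\colon A\to\mathcal C(\mathcal I(A))$, $\iota_A(a)=[a,a]$, is an isomorphism, and $A\mapsto\iota_A$ is a natural isomorphism from the identity functor of $\mathbb Q$ to $\mathcal C\circ\mathcal I$; (iv) for each $J\in\mathbb{IQ}$ the map $\gamma_J\colon J\to\mathcal I(\mathcal C(J))$, $\gamma_J(a)=[\Delta a,\nabla a]$, is a one-to-one homomorphism, and $J\mapsto\gamma_J$ is a natural transformation from the identity functor of $\mathbb{IQ}$ to $\mathcal I\circ\mathcal C$.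
   Context: $\Sigma$ is a set of constant and function symbols containing constants $0,1$. A polarity $\rho$ assigns to each $n$-ary function symbol $f\in\Sigma$ a tuple $\rho(f)\in\{+,-\}^n$. A $\rho$-poalgebra is a pair $(A,\leq)$ with $A$ a $\Sigma$-algebra and $\leq$ a partial order on $A$ such that each $f^A$ is monotone in its $k$-th argument if $\rho(f)_k=+$ and antitone if $\rho(f)_k=-$; it is bounded if $0^A\leq a\leq 1^A$ for all $a$. For a bounded $\rho$-poalgebra $A$, $\mathcal I(A)$ is the $(\Sigma\cup\{\Delta,\nabla,\iota\})$-algebra on $I(A)=\{[a,b]\mid a\leq b\}$ with $f^{\mathcal I(A)}([a_1,b_1],\dots,[a_n,b_n])=[f^A(c_1,\dots,c_n),f^A(d_1,\dots,d_n)]$, where $c_k=a_k,d_k=b_k$ if $\rho(f)_k=+$ and $c_k=b_k,d_k=a_k$ if $\rho(f)_k=-$, $\Delta[a,b]=[a,a]$, $\nabla[a,b]=[b,b]$, $\iota=[0^A,1^A]$. A set $E(x,y)$ of $\Sigma$-equations determines the order of $A$ if $a\leq b$ iff $t^A(a,b)=s^A(a,b)$ for all $t=s$ in $E(x,y)$. Standing assumptions: $\mathbb Q$ is a $\Sigma$-quasivariety of bounded $\rho$-poalgebras whose order is determined by a fixed set $E(x,y)$ of $\Sigma$-equations; $\mathbb{IQ}$ is the quasivariety generated by $\{\mathcal I(A)\mid A\in\mathbb Q\}$; both are categories with homomorphisms. $\mathcal I\colon\mathbb Q\to\mathbb{IQ}$ is the functor $A\mapsto\mathcal I(A)$, $h\mapsto\mathcal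 I(h)$ with $\mathcal I(h)([a,b])=[h(a),h(b)]$. *)

(* Defs.v *)
From mathcomp Require Import all_boot.
From mathcomp Require Import boolp.

Set Implicit Arguments.
Unset Strict Implicit.
Unset Printing Implicit Defensive.

Record signature := Signature {
  csym : Type;
  fsym : Type;
  ar : fsym -> nat }.

Record algebra (S : signature) := Algebra {
  carrier :> Type;
  cst : csym S -> carrier;
  op : forall f : fsym S, ('I_(ar f) -> carrier) -> carrier }.

Arguments cst {S} A c : rename.
Arguments op {S} A f a : rename.

Record is_hom (S : signature) (A B : algebra S) (h : A -> B) : Prop := IsHom {
  hom_cst : forall c, h (cst A c) = cst B c;
  hom_op : forall f (a : 'I_(ar f) -> A),
    h (op A f a) = op B f (fun k => h (a k)) }.

Record hom (S : signature) (A B : algebra S) := Hom {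
  hfun :> A -> B;
  homP : is_hom hfun }.

Inductive term (S : signature) (V : Type) : Type :=
  | Var of V
  | Cst of csym S
  | App (f : fsym S) of ('I_(ar f) -> term S V).

Fixpoint eval (S : signature) (V : Type) (A : algebra S) (v : V -> A)
    (t : term S V) : A :=
  match t with
  | Var x => v x
  | Cst c => cst A c
  | App f ts => op A f (fun k => eval v (ts k))
  end.

Definition equation (S : signature) (V : Type) : Type :=
  (term S V * term S V)%type.

Definition holds (S : signature) (V : Type) (A : algebra S) (v : V -> A)
    (e : equation S V) : Prop :=
  eval v e.1 = eval v e.2.

Record quasiequation (S : signature) := Quasiequation {
  npremises : nat;
  premise : 'I_npremises -> equation S nat;
  conclusion : equation S nat }.

Definition satisfies (S : signature) (A : algebra S) (q : quasiequation S) :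
    Prop :=
  forall v : nat -> A,
    (forall i, holds v (premise (q := q) i)) -> holds v (conclusion q).

Definition quasivariety (S : signature) (K : algebra S -> Prop) : Prop :=
  exists T : quasiequation S -> Prop,
    forall A, K A <-> (forall q, T q -> satisfies A q).

Definition generated_quasivariety (S : signature) (K : algebra S -> Prop)
    (A : algebra S) : Prop :=
  forall V : algebra S -> Prop,
    quasivariety V -> (forall B, K B -> V B) -> V A.

Record obj (S : signature) (K : algebra S -> Prop) := Obj {
  oalg :> algebra S;
  objP : K oalg }.

Lemma is_hom_id (S : signature) (A : algebra S) : @is_hom S A A (fun x => x).
Proof. by []. Qed.

Lemma is_hom_comp (S : signature) (A B C : algebra S) (g : hom B C)
  (h : hom A B) : is_hom (fun x => g (h x)).
Proof.
split=> [c|f a]; first by rewrite (hom_cst (homP h)) (hom_cst (homP g)).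
by rewrite (hom_op (homP h)) (hom_op (homP g)).
Qed.

Definition hid (S : signature) (A : algebra S) : hom A A := Hom (is_hom_id A).

Definition hcomp (S : signature) (A B C : algebra S) (g : hom B C)
  (h : hom A B) : hom A C := Hom (is_hom_comp g h).

Lemma homE (S : signature) (A B : algebra S) (g h : hom A B) :
  (forall x, g x = h x) -> g = h.
Proof.
case: g h => [g gP] [h hP] /= gh.
have {}gh : g = h by apply: funext.
by subst h; congr Hom; apply: Prop_irrelevance.
Qed.

Definition isomorphism (S : signature) (A B : algebra S) (h : hom A B) : Prop :=
  exists k : hom B A, hcomp k h = hid A /\ hcomp h k = hid B.

Record functor_data (S T : signature)
    (K : algebra S -> Prop) (L : algebra T -> Prop) := FunctorData {
  fobj :> obj K -> obj L;
  fmap : forall A B : obj K, hom A B -> hom (fobj A) (fobj B) }.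

Record is_functor (S T : signature)
    (K : algebra S -> Prop) (L : algebra T -> Prop)
    (F : functor_data K L) : Prop := IsFunctor {
  fmap_id : forall A : obj K, fmap F (hid A) = hid (F A);
  fmap_comp : forall (A B C : obj K) (g : hom B C) (h : hom A B),
    fmap F (hcomp g h) = hcomp (fmap F g) (fmap F h) }.

Definition faithful (S T : signature)
    (K : algebra S -> Prop) (L : algebra T -> Prop)
    (F : functor_data K L) : Prop :=
  forall (A B : obj K) (g h : hom A B), fmap F g = fmap F h -> g = h.

Definition id_functor (S : signature) (K : algebra S -> Prop) :
    functor_data K K :=
  @FunctorData S S K K (fun A => A) (fun A B h => h).

Definition comp_functor (S T U : signature) (K : algebra S -> Prop)
    (L : algebra T -> Prop) (M : algebra U -> Prop)
    (G : functor_data L M) (F : functor_data K L) : functor_data K M :=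
  @FunctorData S U K M (fun A => G (F A)) (fun A B h => fmap G (fmap F h)).

Definition natural (S T : signature)
    (K : algebra S -> Prop) (L : algebra T -> Prop)
    (F G : functor_data K L) (tau : forall A : obj K, hom (F A) (G A)) : Prop :=
  forall (A B : obj K) (h : hom A B),
    hcomp (tau B) (fmap F h) = hcomp (fmap G h) (tau A).

Record bsignature := BSignature {
  bsig :> signature;
  czero : csym bsig;
  cone : csym bsig;
  czero_neq_cone : czero <> cone }.

(* true stands for +, false for -. *)
Definition polarity (S : signature) := forall f : fsym S, 'I_(ar f) -> bool.

Record bounded_poalgebra (S : bsignature) (rho : polarity S) (A : algebra S)
    (le : A -> A -> Prop) : Prop := BoundedPoalgebra {
  po_refl : forall a, le a a;
  po_anti : forall a b, le a b -> le b a -> a = b;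
  po_trans : forall a b c, le a b -> le b c -> le a c;
  po_mono : forall f (k : 'I_(ar f)) (a b : 'I_(ar f) -> A),
    (forall j, j != k -> a j = b j) -> le (a k) (b k) ->
    if rho f k then le (op A f a) (op A f b) else le (op A f b) (op A f a);
  po_ge0 : forall a, le (cst A (czero S)) a;
  po_le1 : forall a, le a (cst A (cone S)) }.

Inductive xy := vx | vy.

Definition valxy (A : Type) (a b : A) (w : xy) : A :=
  match w with vx => a | vy => b end.

Definition eq_le (S : signature) (E : equation S xy -> Prop) (A : algebra S)
    (a b : A) : Prop :=
  forall e, E e -> holds (valxy a b) e.

Arguments eq_le {S} E A a b.

Definition determines_order (S : signature) (E : equation S xy -> Prop)
    (A : algebra S) (le : A -> A -> Prop) : Prop :=
  forall a b, le a b <-> eq_le E A a b.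

Definition poalgebras_ordered_by (S : bsignature) (rho : polarity S)
    (E : equation S xy -> Prop) (Q : algebra S -> Prop) : Prop :=
  forall A, Q A ->
    exists le : A -> A -> Prop,
      bounded_poalgebra rho le /\ determines_order E le.

Inductive ecsym (S : signature) := ECst of csym S | EIota.
Inductive efsym (S : signature) := EFun of fsym S | EDelta | ENabla.

Arguments EIota {S}.
Arguments EDelta {S}.
Arguments ENabla {S}.

Definition ext_sig (S : signature) : signature :=
  @Signature (ecsym S) (efsym S)
    (fun f => match f with EFun f => ar f | EDelta | ENabla => 1 end).

Definition ocst (S : signature) (J : algebra (ext_sig S)) (c : csym S) : J :=
  @cst (ext_sig S) J (ECst c).
Definition oop (S : signature) (J : algebra (ext_sig S)) (f : fsym S)
    (a : 'I_(ar f) -> J) : J :=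
  @op (ext_sig S) J (EFun f) a.
Definition Delta (S : signature) (J : algebra (ext_sig S)) (x : J) : J :=
  @op (ext_sig S) J EDelta (fun=> x).
Definition Nabla (S : signature) (J : algebra (ext_sig S)) (x : J) : J :=
  @op (ext_sig S) J ENabla (fun=> x).

Arguments ocst {S} J c.
Arguments oop {S} J f a.

Record interval (A : Type) (le : A -> A -> Prop) := Interval {
  lo : A;
  hi : A;
  lo_le_hi : le lo hi }.

Lemma intervalE (A : Type) (le : A -> A -> Prop) (x y : interval le) :
  lo x = lo y -> hi x = hi y -> x = y.
Proof.
case: x y => [a b ab] [c d cd] /= ac bd; subst c d.
by congr Interval; apply: Prop_irrelevance.
Qed.

Section IntervalAlgebra.
Variables (S : bsignature) (rho : polarity S) (A : algebra S).
Variables (le : A -> A -> Prop) (poA : bounded_poalgebra rho le).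

Definition lo_args (f : fsym S) (x : 'I_(ar f) -> interval le) (k : 'I_(ar f)) :=
  if rho k then lo (x k) else hi (x k).
Definition hi_args (f : fsym S) (x : 'I_(ar f) -> interval le) (k : 'I_(ar f)) :=
  if rho k then hi (x k) else lo (x k).

Lemma op_lo_le_hi (f : fsym S) (x : 'I_(ar f) -> interval le) :
  le (op A f (lo_args x)) (op A f (hi_args x)).
Proof.
pose mix m (j : 'I_(ar f)) := if j < m then hi_args x j else lo_args x j.
have mix0 : mix 0 = lo_args x by apply: funext.
have mixn : mix (ar f) = hi_args x.
  by apply: funext => j; rewrite /mix ltn_ord.
rewrite -mix0 -mixn; have := leqnn (ar f).
elim: {-2}(ar f) => [|m IH] mf; first exact: (po_refl poA).
apply: (po_trans poA (IH (ltnW mf))).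
pose k := Ordinal mf.
have neq j : j != k -> mix m j = mix m.+1 j.
  move=> jk; rewrite /mix ltnS (leq_eqVlt j m).
  by have /negPf -> : nat_of_ord j != m by apply: contra jk => /eqP jm; apply/eqP/val_inj.
have mk : mix m k = lo_args x k by rewrite /mix /= ltnn.
have mk1 : mix m.+1 k = hi_args x k by rewrite /mix /= leqnn.
have := @po_mono _ _ _ _ poA f k (mix m) (mix m.+1) neq.
have := @po_mono _ _ _ _ poA f k (mix m.+1) (mix m)
  (fun j jk => esym (neq j jk)).
rewrite mk mk1 /lo_args /hi_args; case: (rho k) => H1 H2.
  by apply: H2; apply: lo_le_hi.
by apply: H1; apply: lo_le_hi.
Qed.

Definition diag (a : A) : interval le := Interval (po_refl poA a).

Definition interval_cst (c : ecsym S) : interval le :=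
  match c with
  | ECst c => diag (cst A c)
  | EIota => Interval (po_ge0 poA (cst A (cone S)))
  end.

Definition interval_op (f : efsym S) :
    ('I_(@ar (ext_sig S) f) -> interval le) -> interval le :=
  match f with
  | EFun f => fun x => Interval (op_lo_le_hi x)
  | EDelta => fun x => diag (lo (x ord0))
  | ENabla => fun x => diag (hi (x ord0))
  end.

Definition interval_algebra : algebra (ext_sig S) :=
  @Algebra (ext_sig S) (interval le) interval_cst interval_op.

End IntervalAlgebra.

Section IntervalFunctor.
Variables (S : bsignature) (rho : polarity S).
Variables (E : equation S xy -> Prop) (Q : algebra S -> Prop).
Hypothesis ordQ : poalgebras_ordered_by rho E Q.

Lemma eq_le_poalgebra (A : obj Q) : bounded_poalgebra rho (eq_le E A).
Proof.
have [le [leP leE]] := ordQ (objP A).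
suff <- : le = eq_le E A by [].
by apply: funext => a; apply: funext => b; apply: propext.
Qed.

(* The order witnessed by ordQ is necessarily eq_le E A. *)
Definition Ialg (A : obj Q) : algebra (ext_sig S) :=
  interval_algebra (eq_le_poalgebra A).

Definition IQ : algebra (ext_sig S) -> Prop :=
  generated_quasivariety (fun B => exists A : obj Q, B = Ialg A).

Lemma Ialg_IQ (A : obj Q) : IQ (Ialg A).
Proof. by move=> V _; apply; exists A. Qed.

Lemma hom_eval (A B : algebra S) (h : hom A B) V (v : V -> A) (t : term S V) :
  h (eval v t) = eval (fun x => h (v x)) t.
Proof.
elim: t => [x|c|f ts IH] //=; first exact: (hom_cst (homP h)).
by rewrite (hom_op (homP h)); congr (op B f _); apply: funext => k; apply: IH.
Qed.

Lemma hom_eq_le (A B : algebra S) (h : hom A B) (a b : A) :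
  eq_le E A a b -> eq_le E B (h a) (h b).
Proof.
move=> ab e Ee.
have hv : valxy (h a) (h b) = (fun w => h (valxy a b w)).
  by apply: funext; case.
by rewrite /holds hv -!hom_eval (ab e Ee).
Qed.

Definition Ifun (A B : obj Q) (h : hom A B) (x : Ialg A) : Ialg B :=
  Interval (hom_eq_le h (lo_le_hi x)).

Lemma Ifun_hom (A B : obj Q) (h : hom A B) : is_hom (Ifun h).
Proof.
split=> [[c|]|[f||] a]; apply: intervalE => //=; rewrite ?(hom_cst (homP h)) //.
- rewrite (hom_op (homP h)); congr (op B f _); apply: funext => k.
  by rewrite /lo_args; case: (rho k).
- rewrite (hom_op (homP h)); congr (op B f _); apply: funext => k.
  by rewrite /hi_args; case: (rho k).
Qed.

Definition Ifunctor : functor_data Q IQ :=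
  @FunctorData S (ext_sig S) Q IQ (fun A => Obj (Ialg_IQ A))
    (fun A B h => Hom (Ifun_hom h)).

Lemma Ifunctor_is_functor : is_functor Ifunctor.
Proof. by split=> *; apply: homE => x; apply: intervalE. Qed.

End IntervalFunctor.

Section Centre.
Variable S : signature.

Definition Cset (J : algebra (ext_sig S)) (x : J) : Prop :=
  Nabla x = x /\ x = Delta x.

Definition sigma_closed (J : algebra (ext_sig S)) (X : J -> Prop) : Prop :=
  (forall c, X (ocst J c)) /\
  (forall f (a : 'I_(ar f) -> J), (forall k, X (a k)) -> X (oop J f a)).

Definition Calg (J : algebra (ext_sig S)) (clJ : sigma_closed (@Cset J)) :
    algebra S :=
  @Algebra S {x : J | Cset x}
    (fun c => exist _ (ocst J c) (clJ.1 c))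
    (fun f a => exist _ (oop J f (fun k => sval (a k)))
                        (clJ.2 f _ (fun k => svalP (a k)))).

Definition Cfun (J K : algebra (ext_sig S)) (g : J -> K)
    (gC : forall x, Cset x -> Cset (g x)) (x : {x : J | Cset x}) :
    {x : K | Cset x} :=
  exist _ (g (sval x)) (gC _ (svalP x)).

(* The arguments are exactly the well-definedness conditions on C: closure of
   C(J) under the operations, membership of C(J) in Q, and the restrictions
   being homomorphisms between the algebras C(J). *)
Definition Cfunctor (Q : algebra S -> Prop) (R : algebra (ext_sig S) -> Prop)
    (Ccl : forall J : obj R, sigma_closed (@Cset J))
    (CQ : forall J : obj R, Q (Calg (Ccl J)))
    (CC : forall (J K : obj R) (g : hom J K) (x : J), Cset x -> Cset (g x))
    (Chom : forall (J K : obj R) (g : hom J K),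
       @is_hom S (Calg (Ccl J)) (Calg (Ccl K)) (Cfun (@CC J K g))) :
    functor_data R Q :=
  @FunctorData (ext_sig S) S R Q (fun J => Obj (CQ J))
    (fun J K g => Hom (Chom J K g)).

End Centre.

(* Main.v *)
Require Import Defs.
From mathcomp Require Import all_boot.
From mathcomp Require Import boolp.

Set Implicit Arguments.
Unset Strict Implicit.
Unset Printing Implicit Defensive.

(** A member of IQ satisfies every quasi-equation valid in all interval
    algebras I(A).  The elements Delta x and Nabla x are diagonal in I(A), and
    the diagonal of I(A) is a copy of A; hence substituting terms Delta x or
    Nabla x for the variables of a Sigma-term turns facts about Q into
    identities of IQ.  This gives the closure of C(J), the membership
    C(J) in Q, and the inequality Delta a <= Nabla a in C(J).  Injectivity of
    gamma and faithfulness of C both rest on the quasi-equation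
    Delta x = Delta y, Nabla x = Nabla y => x = y. *)

(** * Substitution into Sigma-terms, and the centre under homomorphisms *)

Section ExtendedTerms.
Variable S : signature.

Definition tDelta (V : Type) (t : term (ext_sig S) V) : term (ext_sig S) V :=
  @App (ext_sig S) V EDelta (fun=> t).
Definition tNabla (V : Type) (t : term (ext_sig S) V) : term (ext_sig S) V :=
  @App (ext_sig S) V ENabla (fun=> t).

(** Variables may become extended terms, so that a Sigma-term can be evaluated at elements forced
    into the centre by [Delta] or [Nabla]. *)
Fixpoint subst_ext (V W : Type) (sigma : V -> term (ext_sig S) W)
    (t : term S V) : term (ext_sig S) W :=
  match t with
  | Var x => sigma x
  | Cst c => @Cst (ext_sig S) W (ECst c)
  | App f ts => @App (ext_sig S) W (EFun f) (fun k => subst_ext sigma (ts k))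
  end.

Lemma eval_Calg (J : algebra (ext_sig S)) (clJ : sigma_closed (@Cset S J))
    (V W : Type) (sigma : V -> term (ext_sig S) W) (u : W -> J)
    (v : V -> Calg clJ) (t : term S V) :
  (forall x, eval u (sigma x) = sval (v x)) ->
  eval u (subst_ext sigma t) = sval (eval v t).
Proof.
move=> uv; elim: t => [x|c|f ts IH] //=.
by rewrite /oop; congr (op J _ _); apply: funext => k; apply: IH.
Qed.

Lemma sig_inj (T : Type) (P : T -> Prop) (x y : {z : T | P z}) :
  sval x = sval y -> x = y.
Proof.
case: x y => [x Px] [y Py] /= xy; subst y.
by congr exist; apply: Prop_irrelevance.
Qed.

(** Quasi-equations use variables in [nat], whereas an operation takes a family over an ordinal;
    this turns such a family into a valuation, with [x0] as value beyond the arity. *)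
Lemma ord_fun_extension (T : Type) (x0 : T) n (a : 'I_n -> T) :
  exists v : nat -> T, forall k : 'I_n, v k = a k.
Proof.
exists (fun m => if insub m is Some k then a k else x0) => k.
by rewrite valK.
Qed.

Lemma hom_Delta (J K : algebra (ext_sig S)) (g : hom J K) (x : J) :
  g (Delta x) = Delta (g x).
Proof. exact: (hom_op (homP g)). Qed.

Lemma hom_Nabla (J K : algebra (ext_sig S)) (g : hom J K) (x : J) :
  g (Nabla x) = Nabla (g x).
Proof. exact: (hom_op (homP g)). Qed.

Lemma hom_Cset (J K : algebra (ext_sig S)) (g : hom J K) (x : J) :
  Cset x -> Cset (g x).
Proof.
by case=> nx dx; split; [rewrite -hom_Nabla nx | rewrite -hom_Delta -dx].
Qed.

End ExtendedTerms.

(** * Transfer from the interval algebras to the quasivariety they generate *)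

Section IntervalQuasivariety.
Variables (S : bsignature) (rho : polarity S).
Variables (E : equation S xy -> Prop) (Q : algebra S -> Prop).
Hypothesis ordQ : poalgebras_ordered_by rho E Q.

Local Notation dg A := (diag (eq_le_poalgebra ordQ A)).

(** On diagonal arguments both endpoints coincide, so polarity has no effect and [diag] commutes
    with every Sigma-operation. *)
Lemma eval_diag (A : obj Q) (V W : Type) (sigma : V -> term (ext_sig S) W)
    (u : W -> Ialg ordQ A) (w : V -> A) (t : term S V) :
  (forall x, eval u (sigma x) = dg A (w x)) ->
  eval u (subst_ext sigma t) = dg A (eval w t).
Proof.
move=> uw; elim: t => [x|c|f ts IH] //=.
by apply: intervalE => /=; congr (op A f _); apply: funext => k;
  rewrite /lo_args /hi_args IH; case: (rho k).
Qed.

(** The models of the single quasi-equation [q] form a quasivariety containing all interval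
    algebras, hence all of [IQ]. *)
Lemma IQ_satisfies (J : obj (IQ ordQ)) (q : quasiequation (ext_sig S)) :
  (forall A : obj Q, satisfies (Ialg ordQ A) q) -> satisfies J q.
Proof.
move=> valid_q; apply: (objP J (fun B => satisfies B q)).
  exists (eq q) => B; split=> [Bq _ <- //|]; exact.
by move=> _ [A ->].
Qed.

Lemma IQ_identity (J : obj (IQ ordQ)) (t s : term (ext_sig S) nat)
    (v : nat -> J) :
  (forall (A : obj Q) (u : nat -> Ialg ordQ A), eval u t = eval u s) ->
  eval v t = eval v s.
Proof.
(* An identity is a quasi-equation with an empty family of premises. *)
move=> ts; pose prem (i : 'I_0) : equation (ext_sig S) nat := (t, s).
apply: (@IQ_satisfies J (Quasiequation prem (t, s))); last by case.
by move=> A u _; apply: ts.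
Qed.

(** * Identities of [IQ] and the algebra on the centre *)

Section Identities.
Variable J : obj (IQ ordQ).
Implicit Types x y : J.

Local Notation X := (@Var (ext_sig S) nat 0).

Lemma IQ_DeltaDelta x : Delta (Delta x) = Delta x.
Proof.
by apply: (@IQ_identity J (tDelta (tDelta X)) (tDelta X) (fun=> x)).
Qed.

Lemma IQ_NablaDelta x : Nabla (Delta x) = Delta x.
Proof.
by apply: (@IQ_identity J (tNabla (tDelta X)) (tDelta X) (fun=> x)).
Qed.

Lemma IQ_DeltaNabla x : Delta (Nabla x) = Nabla x.
Proof.
by apply: (@IQ_identity J (tDelta (tNabla X)) (tNabla X) (fun=> x)).
Qed.

Lemma IQ_NablaNabla x : Nabla (Nabla x) = Nabla x.
Proof.
by apply: (@IQ_identity J (tNabla (tNabla X)) (tNabla X) (fun=> x)).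
Qed.

Lemma Cset_Delta x : Cset (Delta x).
Proof. by split; rewrite ?IQ_NablaDelta ?IQ_DeltaDelta. Qed.

Lemma Cset_Nabla x : Cset (Nabla x).
Proof. by split; rewrite ?IQ_NablaNabla ?IQ_DeltaNabla. Qed.

Lemma Cset_ocst c : Cset (ocst J c).
Proof.
pose t := @Cst (ext_sig S) nat (ECst c); pose v (_ : nat) := ocst J c.
by split; [apply: (@IQ_identity J (tNabla t) t v)
          | apply: (@IQ_identity J t (tDelta t) v)].
Qed.

Lemma IQ_Delta_iota :
  Delta (@cst (ext_sig S) J EIota) = ocst J (czero S).
Proof.
by apply: (@IQ_identity J (tDelta (@Cst (ext_sig S) nat EIota))
  (@Cst (ext_sig S) nat (ECst (czero S))) (fun=> ocst J (czero S))).
Qed.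

Lemma IQ_Nabla_iota :
  Nabla (@cst (ext_sig S) J EIota) = ocst J (cone S).
Proof.
by apply: (@IQ_identity J (tNabla (@Cst (ext_sig S) nat EIota))
  (@Cst (ext_sig S) nat (ECst (cone S))) (fun=> ocst J (czero S))).
Qed.

(** In an interval algebra this is the formula for the lower endpoint of an operation: [Delta] and
    [Nabla] pick the endpoint that the polarity prescribes. *)
Lemma IQ_Delta_oop f (a : 'I_(ar f) -> J) :
  Delta (oop J f a) =
  oop J f (fun k => if rho k then Delta (a k) else Nabla (a k)).
Proof.
have [v va] := ord_fun_extension (ocst J (czero S)) a.
pose x (k : 'I_(ar f)) := @Var (ext_sig S) nat k.
pose t := tDelta (@App (ext_sig S) nat (EFun f) x).
pose s := @App (ext_sig S) nat (EFun f)
  (fun k => if rho k then tDelta (x k) else tNabla (x k)).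
have /= := @IQ_identity J t s v; rewrite /Delta /Nabla /oop => ts.
have -> : a = (fun k => v k) by apply: funext => k; rewrite va.
rewrite ts => [|A u].
  by congr (op J _ _); apply: funext => k; case: (rho k).
by apply: intervalE => /=; congr (op A f _); apply: funext => k;
  rewrite /lo_args /hi_args; case: (rho k).
Qed.

Lemma IQ_Nabla_oop f (a : 'I_(ar f) -> J) :
  Nabla (oop J f a) =
  oop J f (fun k => if rho k then Nabla (a k) else Delta (a k)).
Proof.
have [v va] := ord_fun_extension (ocst J (czero S)) a.
pose x (k : 'I_(ar f)) := @Var (ext_sig S) nat k.
pose t := tNabla (@App (ext_sig S) nat (EFun f) x).
pose s := @App (ext_sig S) nat (EFun f)
  (fun k => if rho k then tNabla (x k) else tDelta (x k)).
have /= := @IQ_identity J t s v; rewrite /Delta /Nabla /oop => ts.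
have -> : a = (fun k => v k) by apply: funext => k; rewrite va.
rewrite ts => [|A u].
  by congr (op J _ _); apply: funext => k; case: (rho k).
by apply: intervalE => /=; congr (op A f _); apply: funext => k;
  rewrite /lo_args /hi_args; case: (rho k).
Qed.

(** Central arguments are fixed by both [Delta] and [Nabla], so both branches of the polarity test
    return the argument itself. *)
Lemma Cset_sigma_closed : sigma_closed (@Cset S J).
Proof.
split=> [|f a aC]; first exact: Cset_ocst.
by split; rewrite ?IQ_Delta_oop ?IQ_Nabla_oop; congr (oop J f _);
  apply: funext => k; have [nk dk] := aC k; case: (rho k); rewrite ?nk -?dk.
Qed.

Lemma IQ_Delta_Nabla_inj x y : Delta x = Delta y -> Nabla x = Nabla y -> x = y.
Proof.
move=> dxy nxy; pose Y := @Var (ext_sig S) nat 1.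
pose prem (i : 'I_2) : equation (ext_sig S) nat :=
  if i == ord0 then (tDelta X, tDelta Y) else (tNabla X, tNabla Y).
pose v n := if n is 0 then x else y.
apply: (@IQ_satisfies J (Quasiequation prem (X, Y)) _ v) => [A u uP|i].
  have := uP ord0; rewrite /holds /= => /(congr1 (@lo _ _)) /= luv.
  (* [Nabla] yields a diagonal interval at the upper endpoint, so taking [lo] here compares the
     upper endpoints of the two intervals. *)
  have := uP (lift ord0 ord0); rewrite /holds /= => /(congr1 (@lo _ _)) /= huv.
  exact: intervalE.
by rewrite /holds /= /prem; case: (i == ord0); [exact: dxy|exact: nxy].
Qed.

(** Each axiom [q] of [Q] is translated to [q'] by putting [Delta] on every variable. In an interval
    algebra [q'] says [q] about lower endpoints, so it is valid there and passes to [J]; on central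
    elements of [J], which [Delta] fixes, it is again [q]. *)
Lemma Calg_quasivariety : quasivariety Q -> Q (Calg Cset_sigma_closed).
Proof.
case=> T TP; apply/TP => q Tq v vP.
pose sigma n := tDelta (@Var (ext_sig S) nat n).
pose tr (e : equation S nat) := (subst_ext sigma e.1, subst_ext sigma e.2).
pose q' := Quasiequation (fun i => tr (premise (q := q) i))
  (tr (conclusion q)).
pose u n := sval (v n).
have uv n : eval u (sigma n) = sval (v n) by have [_ /esym] := svalP (v n).
have tr_holds e : holds u (tr e) <-> holds v e.
  rewrite /holds /= !(eval_Calg _ uv).
  by split=> [/sig_inj|->].
apply/tr_holds; apply: (@IQ_satisfies J q' _ u) => [A w wP|i]; last first.
  exact/tr_holds/vP.
pose l n := lo (w n).
have wl n : eval w (sigma n) = dg A (l n) by [].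
have Atr_holds e : holds w (tr e) <-> holds l e.
  rewrite /holds /= !(eval_diag _ wl).
  by split=> [/(congr1 (@lo _ _))|->].
apply/Atr_holds; have /TP/(_ q Tq) := objP A; apply=> i.
exact/Atr_holds/wP.
Qed.

(** The order is expressed by the equations of [E]. Each of them, with [Delta] and [Nabla] of one
    variable substituted, is an identity of all interval algebras because [lo] lies below [hi]. *)
Lemma Calg_Delta_le_Nabla x :
  eq_le E (Calg Cset_sigma_closed)
    (exist _ (Delta x) (Cset_Delta x)) (exist _ (Nabla x) (Cset_Nabla x)).
Proof.
move=> e Ee; set v := valxy _ _.
pose sigma w := if w is vx then tDelta X else tNabla X.
have uv w : eval (fun=> x) (sigma w) = sval (v w) by case: w.
apply: sig_inj; rewrite -!(eval_Calg _ uv); apply: IQ_identity => A u.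
have ul w : eval u (sigma w) = dg A (valxy (lo (u 0)) (hi (u 0)) w).
  by case: w.
by rewrite !(eval_diag _ ul) (lo_le_hi (u 0) e Ee).
Qed.

End Identities.

Lemma Cset_diag (A : obj Q) (a : A) : @Cset S (Ialg ordQ A) (dg A a).
Proof. by split; apply: intervalE. Qed.

Lemma Cset_Ialg_diag (A : obj Q) (x : Ialg ordQ A) :
  Cset x -> x = dg A (lo x).
Proof. by case=> _ {1}->. Qed.

Lemma Cfun_hom (J K : obj (IQ ordQ)) (g : hom J K) :
  @is_hom S (Calg (Cset_sigma_closed J)) (Calg (Cset_sigma_closed K))
    (Cfun (@hom_Cset S J K g)).
Proof.
split=> [c|f a]; apply: sig_inj => /=; first exact: (hom_cst (homP g)).
exact: (hom_op (homP g)).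
Qed.

(** * The functor [C] and the transformations [iota] and [gamma] *)

Section Functors.
Hypothesis quasiQ : quasivariety Q.

Let I := Ifunctor ordQ.
Let C : functor_data (IQ ordQ) Q :=
  Cfunctor (fun J => Calg_quasivariety J quasiQ) Cfun_hom.

Lemma C_is_functor : is_functor C.
Proof. by split=> *; apply: homE => x; apply: sig_inj. Qed.

(** A homomorphism is determined on the centre, which contains [Delta x] and [Nabla x]; these two
    determine the image of [x]. *)
Lemma C_faithful : faithful C.
Proof.
move=> J K g h gh.
have ghC x (xC : Cset x) : g x = h x.
  have /(congr1 (fun k : hom (C J) (C K) => sval (k (exist _ x xC)))) := gh.
  exact.
apply: homE => x; apply: IQ_Delta_Nabla_inj.
  by rewrite -!hom_Delta; apply/ghC/Cset_Delta.
by rewrite -!hom_Nabla; apply/ghC/Cset_Nabla.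
Qed.

Definition iota_fun (A : obj Q) (a : A) : C (I A) :=
  exist _ (dg A a) (Cset_diag a).

Lemma iota_fun_hom (A : obj Q) : is_hom (@iota_fun A).
Proof.
split=> [c|f a]; apply: sig_inj => //=.
by apply: intervalE => /=; congr (op A f _); apply: funext => k;
  rewrite /lo_args /hi_args; case: (rho k).
Qed.

Definition iota_inv_fun (A : obj Q) (x : C (I A)) : A := lo (sval x).

Lemma iota_inv_fun_hom (A : obj Q) : is_hom (@iota_inv_fun A).
Proof.
split=> [//|f a]; rewrite /iota_inv_fun /=; congr (op A f _).
(* For an antitone argument [lo_args] reads [hi], which equals [lo] on a central interval. *)
apply: funext => k; rewrite /lo_args (Cset_Ialg_diag (svalP (a k))) /=.
by case: (rho k).
Qed.

Definition iota_hom (A : obj Q) : hom A (C (I A)) := Hom (@iota_fun_hom A).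

Lemma iota_isomorphism (A : obj Q) : isomorphism (iota_hom A).
Proof.
exists (Hom (@iota_inv_fun_hom A)); split; apply: homE => x //=.
by apply: sig_inj => /=; rewrite -Cset_Ialg_diag //; apply: svalP.
Qed.

Lemma iota_natural :
  natural (F := id_functor Q) (G := comp_functor C I) iota_hom.
Proof.
by move=> A B h; apply: homE => x; apply: sig_inj; apply: intervalE.
Qed.

Definition gamma_fun (J : obj (IQ ordQ)) (a : J) : I (C J) :=
  Interval (Calg_Delta_le_Nabla a).

Lemma gamma_fun_hom (J : obj (IQ ordQ)) : is_hom (@gamma_fun J).
Proof.
split=> [[c|]|[f||] a]; apply: intervalE; apply: sig_inj => /=.
- by have [_ <-] := Cset_ocst J c.
- by have [-> _] := Cset_ocst J c.
- exact: IQ_Delta_iota.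
- exact: IQ_Nabla_iota.
- rewrite [LHS]IQ_Delta_oop; congr (oop J f _); apply: funext => k.
  by rewrite /lo_args /=; case: (rho k).
- rewrite [LHS]IQ_Nabla_oop; congr (oop J f _); apply: funext => k.
  by rewrite /hi_args /=; case: (rho k).
(* Four goals remain, the two endpoints for [Delta] and for [Nabla]; a family over ['I_1] is made
   constant to match their definitions. *)
all: have -> : a = (fun=> a ord0) by apply: funext => k; rewrite ord1.
- exact: IQ_DeltaDelta.
- exact: IQ_NablaDelta.
- exact: IQ_DeltaNabla.
- exact: IQ_NablaNabla.
Qed.

Definition gamma_hom (J : obj (IQ ordQ)) : hom J (I (C J)) :=
  Hom (@gamma_fun_hom J).

Lemma gamma_injective (J : obj (IQ ordQ)) : injective (gamma_hom J).
Proof.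
move=> x y xy; apply: IQ_Delta_Nabla_inj.
  exact: (congr1 (fun z : I (C J) => sval (lo z)) xy).
exact: (congr1 (fun z : I (C J) => sval (hi z)) xy).
Qed.

Lemma gamma_natural :
  natural (F := id_functor (IQ ordQ)) (G := comp_functor I C) gamma_hom.
Proof.
move=> J K g; apply: homE => x; apply: intervalE; apply: sig_inj => /=.
  by rewrite hom_Delta.
by rewrite hom_Nabla.
Qed.

End Functors.

End IntervalQuasivariety.

Theorem theorem8p7 (S : bsignature) (rho : polarity S)
    (E : equation S xy -> Prop) (Q : algebra S -> Prop)
    (quasiQ : quasivariety Q) (ordQ : poalgebras_ordered_by rho E Q) :
  let I : functor_data Q (IQ ordQ) := Ifunctor ordQ in
  (* (i) *)
  exists Ccl : (forall J : obj (IQ ordQ), sigma_closed (@Cset S J)),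
  (* (ii) *)
  exists (CQ : forall J : obj (IQ ordQ), Q (Calg (Ccl J)))
         (CC : forall (J K : obj (IQ ordQ)) (g : hom J K) (x : J),
                 Cset x -> Cset (g x))
         (Chom : forall (J K : obj (IQ ordQ)) (g : hom J K),
            @is_hom S (Calg (Ccl J)) (Calg (Ccl K)) (Cfun (CC J K g))),
  let C : functor_data (IQ ordQ) Q := Cfunctor CQ Chom in
  [/\ is_functor C,
      faithful C,
      (* (iii) *)
      exists iota : forall A : obj Q, hom A (C (I A)),
        [/\ forall (A : obj Q) (a : A),
              sval (iota A a) = diag (eq_le_poalgebra ordQ A) a,
            forall A : obj Q, isomorphism (iota A)
          & natural (F := id_functor Q) (G := comp_functor C I) iota]
      (* (iv) *)
    & exists gamma : forall J : obj (IQ ordQ), hom J (I (C J)),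
        [/\ forall (J : obj (IQ ordQ)) (a : J),
              sval (lo (gamma J a)) = Delta a /\
              sval (hi (gamma J a)) = Nabla a,
            forall J : obj (IQ ordQ), injective (gamma J)
          & natural (F := id_functor (IQ ordQ)) (G := comp_functor I C) gamma]].
Proof.
move=> I.
exists (@Cset_sigma_closed S rho E Q ordQ).
exists (fun J => Calg_quasivariety J quasiQ).
exists (fun J K g => @hom_Cset S J K g), (@Cfun_hom S rho E Q ordQ) => C.
split; [exact: C_is_functor|exact: C_faithful| |].
  exists (iota_hom ordQ quasiQ).
  by split=> //; [exact: iota_isomorphism|exact: iota_natural].
exists (gamma_hom quasiQ).
by split=> //; [exact: gamma_injective|exact: gamma_natural].
Qed.
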